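(* Let $G$ be the graph whose vertices are the points of ${\mathbb R}^2$, with an edge between any pair of points at Euclidean distance exactly $1$. Let $c$ be a proper colouring of $G$ with the following property: there are a point $P$ of ${\mathbb R}^2$, a closed half-plane $H$ with complementary closed half-plane $H'$, a neighbourhood $N$ of $P$, and two colours $a\neq b$, such that $P$ lies on the line $H\cap H'$, $c$ colours each point of the interior of $H\cap N$ with colour $a$, and $c$ colours each point of the interior of $H'\cap N$ with colour $b$. Then $c$ uses at least $5$ colours.
   Context: A proper colouring of $G$ is an assignment of colours to all points of ${\mathbb R}^2$ such that any two points at distance exactly $1$ receive different colours. For a closed half-plane $H$ bounded by a line $L$, the complementary closed half-plane $H'$ is the closed half-plane on the other side of $L$, so that $H\cup H'={\mathbb R}^2$ and $H\cap H'=L$. *)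

(* Defs.v *)
From mathcomp Require Import all_boot all_order all_algebra.
From mathcomp Require Import all_classical all_reals all_analysis.

Set Implicit Arguments.
Unset Strict Implicit.
Unset Printing Implicit Defensive.

Import Order.TTheory GRing.Theory Num.Theory.
Import numFieldNormedType.Exports.

Local Open Scope classical_set_scope.
Local Open Scope ring_scope.

(* The library norm on R * R is the sup norm, so the Euclidean distance is
   written out; both induce the product topology, from which nbhs and interior
   are taken. *)
Definition edist (R : realType) (p q : R * R) : R :=
  Num.sqrt ((p.1 - q.1) ^+ 2 + (p.2 - q.2) ^+ 2).

Definition unit_distance_graph (R : realType) (p q : R * R) : Prop :=
  edist p q = 1.

Definition proper_colouring (V C : Type) (adj : V -> V -> Prop) (c : V -> C)
  : Prop := forall p q, adj p q -> c p <> c q.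

Definition line (R : realType) (u : R * R) (t : R) : set (R * R) :=
  [set p | u.1 * p.1 + u.2 * p.2 = t].

Definition half_plane (R : realType) (u : R * R) (t : R) : set (R * R) :=
  [set p | t <= u.1 * p.1 + u.2 * p.2].

(* Negating (u, t) reverses the inequality and keeps the bounding line. *)
Definition complementary_half_planes (R : realType) (H H' : set (R * R))
  : Prop :=
  exists (u : R * R) (t : R),
    [/\ u != 0, H = half_plane u t & H' = half_plane (- u) (- t)].

Lemma half_planeU (R : realType) (u : R * R) (t : R) :
  half_plane u t `|` half_plane (- u) (- t) = setT.
Proof.
apply/seteqP; split=> // p _; rewrite /half_plane /=.
by rewrite !mulNr -opprD lerN2; apply/orP; exact: le_total.
Qed.

Lemma half_planeI (R : realType) (u : R * R) (t : R) :
  half_plane u t `&` half_plane (- u) (- t) = line u t.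
Proof.
apply/seteqP; split=> p; rewrite /half_plane /line /= !mulNr -opprD lerN2.
  by move=> [h1 h2]; apply/eqP; rewrite eq_le h2 h1.
by move=> ->.
Qed.

(* `I_k is the set of naturals below k: at least k distinct values are taken. *)
Definition uses_at_least (V C : Type) (k : nat) (c : V -> C) : Prop :=
  (`I_k #<= range c)%card.

(* Main.v *)
Require Import Defs.
From mathcomp Require Import all_boot all_order all_algebra.
From mathcomp Require Import all_classical all_reals all_analysis.
From mathcomp Require Import ring lra.
Import Order.TTheory GRing.Theory Num.Theory.
Import numFieldNormedType.Exports.
Local Open Scope classical_set_scope.
Local Open Scope ring_scope.

(** Suppose that only four colours occur. Put the boundary line along the first
axis and [P] at the origin, so that near the origin the points above the axis
have colour [a] and those below it colour [b]. A point with unit neighbours in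
both of these regions has neither colour. This applies to every point of the
unit circle off the vertical axis, because the unit circle around it crosses
the first axis transversally at the origin ([sees_both_sides_circle]). Being an
open condition, it also applies to all points in a thin neighbourhood of the
arc of angles in [[-pi/6, pi/6]] ([sees_both_sides_near_arc]). Hence all these
points share the two remaining colours.

Two colours do not suffice for them, because they contain an odd unit-distance
cycle ([no_two_colouring_near_arc]). Write [h = pi / 6 / N] with [N] large and
take a point of the unit circle at angle [t]. Turn it by [pi/3], then
move to the apex of the rhombus whose other vertices are the origin and the
points at angles [t + pi/3] and [t + 2h - pi/3], then to the last of these, and
turn by [pi/3] once more. These four unit steps end at angle [t + 2h]. The
rhombus has angle just below [2 pi/3] at the origin, so the apex has distance
about [1] from it and lies near the arc, at angle [t + h]. Starting at angle
[-pi/6], after [N] such moves one has gone an even number of steps and arrives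
at angle [pi/6], which is at distance [1] from the start. *)

(** * Unit distances in polar coordinates *)

Definition polar {R : realType} (r t : R) : R * R := (r * cos t, r * sin t).

Lemma unit_distance_graphE {R : realType} {p q : R * R} :
  unit_distance_graph p q <-> (p.1 - q.1) ^+ 2 + (p.2 - q.2) ^+ 2 = 1.
Proof.
rewrite /unit_distance_graph /Defs.edist; split=> h; last by rewrite h sqrtr1.
have s0 : 0 <= (p.1 - q.1) ^+ 2 + (p.2 - q.2) ^+ 2.
  by rewrite addr_ge0 ?sqr_ge0.
by rewrite -(sqr_sqrtr s0) h expr1n.
Qed.

Lemma unit_distance_graphC {R : realType} {p q : R * R} :
  unit_distance_graph p q -> unit_distance_graph q p.
Proof.
by move/unit_distance_graphE => h; apply/unit_distance_graphE; rewrite -h; ring.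
Qed.

(** The triple angle formula at [pi/3] gives [(x + 1) (2 x - 1)^2 = 0] for the
cosine [x], which is positive. *)
Lemma cos_pithird (R : realType) : cos (pi / 3) = 1 / 2 :> R.
Proof.
have c0 : 0 < cos (pi / 3 : R).
  by apply: cos_gt0_pihalf; have := pi_gt0 R; lra.
have e : cos (pi / 3 + pi / 3 + pi / 3 : R) = -1.
  by rewrite -cospi; congr cos; lra.
rewrite !(cosD, sinD) in e.
have s2 := cos2Dsin2 (pi / 3 : R).
have : (cos (pi / 3 : R) + 1) * (2 * cos (pi / 3) - 1) ^+ 2 = 0.
  move: e s2; set x := cos _; set y := sin _ => e s2.
  have {s2} s2 : y * y = 1 - x ^+ 2 by rewrite -expr2; lra.
  have : x ^+ 3 - 3 * x * (y * y) = -1 by rewrite -e; ring.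
  rewrite s2 => h.
  have -> : (x + 1) * (2 * x - 1) ^+ 2 = x ^+ 3 - 3 * x * (1 - x ^+ 2) + 1.
    by ring.
  by rewrite h; ring.
move/eqP; rewrite mulf_eq0 sqrf_eq0 => /orP[] /eqP; lra.
Qed.

Lemma adjacent_pithird {R : realType} (t : R) :
  unit_distance_graph (polar 1 t) (polar 1 (t + pi / 3)).
Proof.
apply/unit_distance_graphE; rewrite /= !mul1r.
have -> : forall a b c d : R, (a - b) ^+ 2 + (c - d) ^+ 2 =
  (a ^+ 2 + c ^+ 2) + (b ^+ 2 + d ^+ 2) - 2 * (b * a + d * c).
  by move=> *; ring.
rewrite !cos2Dsin2 -cosB.
have -> : t + pi / 3 - t = pi / 3 by ring.
by rewrite cos_pithird; field.
Qed.

(** The apex opposite the origin in the rhombus on the unit vectors of angles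
[m + b] and [m - b] is their sum, which has length [2 * cos b] and angle [m]. *)
Lemma adjacent_rhombus {R : realType} (m b : R) :
  unit_distance_graph (polar (2 * cos b) m) (polar 1 (m + b)).
Proof.
apply/unit_distance_graphE; rewrite /= !mul1r cosD sinD.
apply: etrans (cos2Dsin2 (m - b)); rewrite cosB sinB; ring.
Qed.

Lemma adjacent_unit_vector {R : realType} (r t : R) (v : R) :
  unit_distance_graph (polar r t)
    (r * cos t - cos v, r * sin t - sin v).
Proof.
apply/unit_distance_graphE => /=.
apply: etrans (cos2Dsin2 v); ring.
Qed.

(** * Points adjacent to both sides of the first axis near the origin *)

Definition in_box {R : realType} (e : R) (q : R * R) : Prop :=
  `|q.1| < e /\ `|q.2| < e.

Definition sees_both_sides {R : realType} (e : R) (p : R * R) : Prop :=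
  (exists q, [/\ unit_distance_graph p q, in_box e q & 0 < q.2]) /\
  (exists q, [/\ unit_distance_graph p q, in_box e q & q.2 < 0]).

(** For [r = 1] the point [q] ends a chord of half-angle [a] through the origin,
on the unit circle around [polar 1 m]; its height is
[- 2 * sin a * cos (m + a)]. The bounds say how far a general [r] perturbs this. *)
Lemma chord_estimates {R : realType} (r m a : R) :
  let q := (r * cos m - cos (m + a + a), r * sin m - sin (m + a + a)) in
  [/\ `|q.1| <= `|r - 1| + 2 * `|sin a|,
      `|q.2| <= `|r - 1| + 2 * `|sin a| &
      `|q.2 + 2 * sin a * cos (m + a)| <= `|r - 1| ].
Proof.
have e1 : r * cos m - cos (m + a + a) =
    (r - 1) * cos m + 2 * (sin a * sin (m + a)).
  have -> : cos m = cos (m + a - a) by congr cos; ring.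
  by rewrite (cosB (m + a)) (cosD (m + a)); ring.
have e2 : r * sin m - sin (m + a + a) =
    (r - 1) * sin m - 2 * (sin a * cos (m + a)).
  have -> : sin m = sin (m + a - a) by congr sin; ring.
  by rewrite (sinB (m + a)) (sinD (m + a)); ring.
have cos_abs x : `|cos x : R| <= 1 by rewrite ler_norml cos_geN1 cos_le1.
have sin_abs x : `|sin x : R| <= 1 by rewrite ler_norml sin_geN1 sin_le1.
rewrite /= e1 e2; split.
- rewrite (le_trans (ler_normD _ _))// !normrM (ger0_norm (ler0n _ 2)).
  by rewrite lerD// ?ler_pM2l// ler_piMr.
- rewrite (le_trans (ler_normB _ _))// !normrM (ger0_norm (ler0n _ 2)).
  by rewrite lerD// ?ler_pM2l// ler_piMr.
- rewrite -mulrA subrK normrM ler_piMr//.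
Qed.

(** The two chords of half-angles [a] and [- a] leave the origin on opposite
sides of the axis, and the perturbation [r - 1] is too small to undo this. *)
Lemma sees_both_sides_polar {R : realType} (e r m a : R) :
  0 < sin a -> `|r - 1| + 2 * sin a < e ->
  `|r - 1| < 2 * sin a * cos (m + a) -> `|r - 1| < 2 * sin a * cos (m - a) ->
  sees_both_sides e (polar r m).
Proof.
move=> sa0 small hD hB; split.
- have [b1 b2 b3] := chord_estimates r m (- a).
  exists (r * cos m - cos (m - a - a), r * sin m - sin (m - a - a)).
  move: b1 b2 b3; rewrite sinN normrN (gtr0_norm sa0) => b1 b2 b3.
  split; first exact: adjacent_unit_vector.
  + by split; exact: le_lt_trans small.
  + by move: b3; rewrite ler_norml => /andP[b3 _]; lra.
- have [b1 b2 b3] := chord_estimates r m a.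
  exists (r * cos m - cos (m + a + a), r * sin m - sin (m + a + a)).
  move: b1 b2 b3; rewrite (gtr0_norm sa0) => b1 b2 b3.
  split; first exact: adjacent_unit_vector.
  + by split; exact: le_lt_trans small.
  + by move: b3; rewrite ler_norml => /andP[_ b3]; lra.
Qed.

Lemma small_angle {R : realType} (e b : R) : 0 < e -> 0 < b ->
  exists a, [/\ 0 < a, a < b, 0 < sin a & 2 * sin a < e].
Proof.
move=> e0 b0.
have /cvgrPdist_lt /(_ (e / 2) ltac:(lra)) [d /= d0 hd] := @continuous_sin R 0.
have pi0 := pi_gt0 R.
pose a := Num.min (d / 2) (Num.min (b / 2) (pi / 2)).
have a0 : 0 < a by rewrite !lt_min; apply/and3P; split; lra.
have [ad ab ap] : [/\ a <= d / 2, a <= b / 2 & a <= pi / 2].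
  by rewrite /a !ge_min !lexx !orbT.
exists a; split=> //; first lra.
  by apply: sin_gt0_pi; lra.
have := hd a; rewrite /ball_ /= sin0 !sub0r !normrN (gtr0_norm a0).
by move=> /(_ ltac:(lra)); rewrite ltr_norml => /andP[_]; lra.
Qed.

Lemma sees_both_sides_circle {R : realType} (e m : R) :
  0 < e -> `|m| < pi / 2 -> sees_both_sides e (polar 1 m).
Proof.
move=> e0 hm.
have [a [a0 am sa se]] := small_angle e (pi / 2 - `|m|) e0 ltac:(lra).
have [m1 m2] : m <= `|m| /\ - m <= `|m|.
  by rewrite ler_norm -normrN ler_norm.
apply: (sees_both_sides_polar e 1 m a) => //.
- by rewrite subrr normr0; lra.
- rewrite subrr normr0 pmulr_rgt0; last lra.
  by apply: cos_gt0_pihalf; lra.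
- rewrite subrr normr0 pmulr_rgt0; last lra.
  by apply: cos_gt0_pihalf; lra.
Qed.

Lemma cos_ge_half {R : realType} (m : R) : `|m| <= pi / 3 -> 1 / 2 <= cos m.
Proof.
move=> hm; have pi0 := pi_gt0 R.
have <- : cos `|m| = cos m by case: (ger0P m) => _ //; rewrite cosN.
rewrite -cos_pithird leNgt ltr_cos ?in_itv/= ?normr_ge0 -?leNgt//; lra.
Qed.

(** What makes [d] uniform in [m] is that on the arc, and even on its enlargement
by the chord half-angle, the cosine is at least [1/2]. *)
Lemma sees_both_sides_near_arc {R : realType} (e : R) : 0 < e ->
  exists2 d, 0 < d & forall r m,
    `|r - 1| < d -> `|m| <= pi / 6 -> sees_both_sides e (polar r m).
Proof.
move=> e0; have pi0 := pi_gt0 R.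
have [a [a0 am sa se]] := small_angle (e / 2) (pi / 6) ltac:(lra) ltac:(lra).
exists (Num.min (e / 2) (sin a)); first by rewrite lt_min sa; lra.
move=> r m; rewrite lt_min ler_norml => /andP[r1 r2] /andP[m1 m2].
apply: (sees_both_sides_polar e r m a) => //.
- lra.
- have : 1 / 2 <= cos (m + a) by apply: cos_ge_half; rewrite ler_norml; lra.
  nra.
- have : 1 / 2 <= cos (m - a) by apply: cos_ge_half; rewrite ler_norml; lra.
  nra.
Qed.

(** * An odd cycle near the arc *)

Lemma rhombus_angle {R : realType} (d : R) : 0 < d ->
  exists n : nat, `|2 * cos (pi / 3 - pi / 6 / n.+1%:R) - 1| < d.
Proof.
move=> d0; have pi0 := pi_gt0 R.
have /cvgrPdist_lt /(_ (d / 2) ltac:(lra)) [b /= b0 hb] :=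
  @continuous_cos R (pi / 3).
have := truncnS_gt (pi / 6 / b); set n := Num.trunc _ => hn.
exists n; have nb : pi / 6 / n.+1%:R < b.
  by rewrite ltr_pdivrMr// [ltRHS]mulrC -ltr_pdivrMr.
have h0 : 0 < pi / 6 / n.+1%:R :> R by rewrite divr_gt0//; lra.
move: nb h0; set h := pi / 6 / n.+1%:R => nb h0.
have := hb (pi / 3 - h); rewrite /ball_ /= opprB addrC subrK (gtr0_norm h0).
move=> /(_ nb); rewrite cos_pithird distrC !ltr_norml => /andP[? ?].
by apply/andP; split; lra.
Qed.

Lemma two_colours_alternate {V C : Type} {adj : V -> V -> Prop} {c : V -> C}
    {x y : C} {p : V} (q : V) {r : V} :
  proper_colouring adj c -> adj p q -> adj q r ->
  c p = x \/ c p = y -> c q = x \/ c q = y -> c r = x \/ c r = y ->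
  c p = c r.
Proof.
by move=> cP /cP pq /cP qr [] p1 [] q1 [] r1; congruence.
Qed.

(** The odd cycle consists of [n.+1] paths of four unit steps along the arc, each
advancing the angle by [2 * h], and a closing unit step from angle [pi/6] back
to [- (pi/6)]. All angles of points on the unit circle stay strictly between
[- (pi/2)] and [pi/2]: the middle points of a path from [t] to [t + 2 * h] have
angles [t + pi/3 <= pi/2 - 2 * h] and [t + 2 * h - pi/3 >= - (pi/2) + 2 * h]. *)
Lemma no_two_colouring_near_arc {R : realType} {C : Type} (c : R * R -> C)
    (d : R) (x y : C) :
  proper_colouring (@unit_distance_graph R) c -> 0 < d ->
  (forall m, `|m| < pi / 2 -> c (polar 1 m) = x \/ c (polar 1 m) = y) ->
  (forall r m, `|r - 1| < d -> `|m| <= pi / 6 ->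
    c (polar r m) = x \/ c (polar r m) = y) ->
  False.
Proof.
move=> cP d0 circ arc; have pi0 := pi_gt0 R.
have [n hn] := rhombus_angle d d0.
move: hn; set h := pi / 6 / n.+1%:R => hn.
have h0 : 0 < h by rewrite divr_gt0//; lra.
have hN : n.+1%:R * h = pi / 6 by rewrite mulrC divfK ?pnatr_eq0.
pose t (k : nat) : R := - (pi / 6) + 2 * (k%:R * h).
have tS k : t k.+1 = t k + 2 * h by rewrite /t -natr1; ring.
have t_ge k : - (pi / 6) <= t k.
  by rewrite /t lerDl mulr_ge0// mulr_ge0// ltW.
have t_le k : (k <= n.+1)%N -> t k <= pi / 6.
  rewrite /t -(ler_nat R) => hk.
  have : k%:R * h <= n.+1%:R * h by rewrite ler_pM2r.
  by rewrite hN; lra.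
have step k : (k < n.+1)%N -> c (polar 1 (t k)) = c (polar 1 (t k.+1)).
  move=> kn; have := t_le k.+1 kn; have := t_ge k; rewrite tS => tk1 tk2.
  have circ' m : - (pi / 2) < m < pi / 2 ->
      c (polar 1 m) = x \/ c (polar 1 m) = y.
    by move=> mb; apply: circ; rewrite ltr_norml.
  pose b := pi / 3 - h; pose m := t k + h.
  have e1 : m + b = t k + pi / 3 by rewrite /m /b; ring.
  have e2 : m + - b = t k + 2 * h - pi / 3 by rewrite /m /b; ring.
  have apex : c (polar (2 * cos b) m) = x \/ c (polar (2 * cos b) m) = y.
    by apply: arc => //; rewrite ler_norml /m; lra.
  apply: (@etrans _ _ (c (polar (2 * cos b) m))).
    apply: (two_colours_alternate (polar 1 (m + b)) cP _ _ _ _ apex).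
    - by rewrite e1; exact: adjacent_pithird.
    - exact/unit_distance_graphC/adjacent_rhombus.
    - by apply: circ'; lra.
    - by apply: circ'; lra.
  apply: (two_colours_alternate (polar 1 (m + - b)) cP _ _ apex).
  - by rewrite -(cosN b); exact: adjacent_rhombus.
  - have -> : t k + 2 * h = m + - b + pi / 3 by rewrite e2; ring.
    exact: adjacent_pithird.
  - by apply: circ'; lra.
  - by apply: circ'; lra.
have const k : (k <= n.+1)%N -> c (polar 1 (t 0%N)) = c (polar 1 (t k)).
  elim: k => [_|k IH kn]; first by [].
  exact: etrans (IH (ltnW kn)) (step k kn).
apply: (cP (polar 1 (t 0%N)) (polar 1 (t n.+1))); last exact: const.
have -> : t n.+1 = t 0%N + pi / 3 by rewrite /t hN; lra.
exact: adjacent_pithird.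
Qed.

(** * Five colours for a horizontal boundary *)

Lemma uses_at_least_inj {V C : Type} {k : nat} {c : V -> C} (p : nat -> V) :
  {in `I_k &, injective (c \o p)} -> uses_at_least k c.
Proof.
move=> /inj_card_eq; rewrite card_eq_le => /andP[_ le_image].
apply: card_le_trans le_image _; apply: subset_card_le.
by move=> _ [i _ <-]; exists (p i).
Qed.

(** The ends [p] and [q] of the closing edge of the odd cycle supply two colours
besides [a] and [b]. Without a fifth colour, every point that sees both sides
repeats one of these two. *)
Lemma straight_boundary_five_colours {R : realType} {C : Type}
    (c : R * R -> C) (e : R) (a b : C) :
  proper_colouring (@unit_distance_graph R) c -> 0 < e -> a <> b ->
  (forall q, in_box e q -> 0 < q.2 -> c q = a) ->
  (forall q, in_box e q -> q.2 < 0 -> c q = b) ->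
  uses_at_least 5 c.
Proof.
move=> cP e0 ab up down; apply: contrapT => few; have pi0 := pi_gt0 R.
have not_ab p : sees_both_sides e p -> c p <> a /\ c p <> b.
  move=> [[q [/cP pq qe q0]] [q' [/cP pq' qe' q0']]].
  by rewrite -(up q)// -(down q').
have pole s : `|s| < e -> in_box e (0, s) by move=> se; split; rewrite ?normr0.
have ca : c (0, e / 2) = a.
  by apply: up => /=; [apply: pole; rewrite gtr0_norm|]; lra.
have cb : c (0, - (e / 2)) = b.
  by apply: down => /=; [apply: pole; rewrite normrN gtr0_norm|]; lra.
set p := polar 1 (- (pi / 6) : R); set q := polar 1 (- (pi / 6) + pi / 3 : R).
have pq : c p <> c q by apply/cP/adjacent_pithird.
have circle m : `|m| < pi / 2 -> sees_both_sides e (polar 1 m).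
  exact: sees_both_sides_circle.
have [pa pb] : c p <> a /\ c p <> b.
  by apply/not_ab/circle; rewrite ltr_norml; lra.
have [qa qb] : c q <> a /\ c q <> b.
  by apply/not_ab/circle; rewrite ltr_norml; lra.
have two r : sees_both_sides e r -> c r = c p \/ c r = c q.
  move=> /not_ab[ra rb]; apply: contrapT => /not_orP[rp rq]; apply: few.
  apply: (uses_at_least_inj (nth r [:: (0, e / 2); (0, - (e / 2)); p; q])).
  move=> [|[|[|[|[|i]]]]] [|[|[|[|[|j]]]]] /set_mem //= hi /set_mem //= hj;
    rewrite ?ca ?cb; congruence.
have [d d0 arc] := sees_both_sides_near_arc e e0.
apply: (no_two_colouring_near_arc c d (c p) (c q) cP d0).
- by move=> m /circle /two.
- by move=> r m rd mb; apply/two/arc.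
Qed.

(** * Reduction of the general half-plane to the horizontal one *)

(** For a unit vector [w] this is the rigid motion taking the origin to [P] and
the upward vertical direction to [w]. *)
Definition frame {R : realType} (P w q : R * R) : R * R :=
  (P.1 + q.1 * w.2 + q.2 * w.1, P.2 - q.1 * w.1 + q.2 * w.2).

Lemma frame_unit_distance {R : realType} {P w p q : R * R} :
  w.1 ^+ 2 + w.2 ^+ 2 = 1 -> unit_distance_graph p q ->
  unit_distance_graph (frame P w p) (frame P w q).
Proof.
move=> w1 /unit_distance_graphE pq; apply/unit_distance_graphE => /=.
transitivity ((w.1 ^+ 2 + w.2 ^+ 2) *
  ((p.1 - q.1) ^+ 2 + (p.2 - q.2) ^+ 2)); first by ring.
by rewrite w1 pq mul1r.
Qed.

Lemma unit_vector_scaling {R : realType} {u : R * R} : u != 0 ->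
  exists (s : R) (w : R * R),
    [/\ 0 < s, u = (s * w.1, s * w.2) & w.1 ^+ 2 + w.2 ^+ 2 = 1].
Proof.
case: u => u1 u2 u_neq0.
have sq_gt0 : 0 < u1 ^+ 2 + u2 ^+ 2.
  rewrite lt_def addr_ge0 ?sqr_ge0// andbT paddr_eq0 ?sqr_ge0// !sqrf_eq0.
  by apply: contraNN u_neq0 => /andP[/eqP -> /eqP ->].
have s_gt0 : 0 < Num.sqrt (u1 ^+ 2 + u2 ^+ 2) by rewrite sqrtr_gt0.
have s_neq0 := lt0r_neq0 s_gt0.
exists (Num.sqrt (u1 ^+ 2 + u2 ^+ 2)), (u1 / Num.sqrt (u1 ^+ 2 + u2 ^+ 2),
  u2 / Num.sqrt (u1 ^+ 2 + u2 ^+ 2)); split=> //=.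
  by rewrite ![Num.sqrt _ * _]mulrC !divfK.
rewrite !expr_div_n sqr_sqrtr ?ltW// -mulrDl divff//; exact: lt0r_neq0.
Qed.

Lemma open_half_plane_interior {R : realType} (u : R * R) (t : R) :
  [set p | t < u.1 * p.1 + u.2 * p.2] `<=` (half_plane u t)°.
Proof.
rewrite -open_subsetE; first by move=> p /=; exact: ltW.
apply: (@open_comp _ _ (fun p : R * R => u.1 * p.1 + u.2 * p.2)
  [set x | t < x]); last exact: open_gt.
move=> p _; apply: cvgD; apply: cvgM; first [exact: cvg_cst|exact: cvg_fst|exact: cvg_snd].
Qed.

Lemma frame_near {R : realType} {P w : R * R} {N : set (R * R)} :
  w.1 ^+ 2 + w.2 ^+ 2 = 1 -> nbhs P N ->
  exists2 e, 0 < e & forall q, in_box e q -> N (frame P w q).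
Proof.
move=> w1 /nbhs_ballP[e /= e0 eN]; exists (e / 2); first lra.
have wi : `|w.1| <= 1 /\ `|w.2| <= 1.
  rewrite !ler_norml; nra.
move=> q [q1 q2]; apply: eN.
have bound x y : `|x| <= 1 -> `|y| <= 1 -> `|q.1 * x + q.2 * y| < e.
  move=> x1 y1; rewrite (le_lt_trans (ler_normD _ _))// !normrM.
  have : `|q.1| * `|x| <= `|q.1| by rewrite ler_piMr.
  have : `|q.2| * `|y| <= `|q.2| by rewrite ler_piMr.
  lra.
split; rewrite /ball /= /ball_ /=.
- have -> : P.1 - (P.1 + q.1 * w.2 + q.2 * w.1) = - (q.1 * w.2 + q.2 * w.1).
    by ring.
  by rewrite normrN bound//; case: wi.
- have -> : P.2 - (P.2 - q.1 * w.1 + q.2 * w.2) =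
    - (q.1 * (- w.1) + q.2 * w.2) by ring.
  by rewrite normrN bound ?normrN//; case: wi.
Qed.

Theorem theorem4 (R : realType) (C : Type) (c : R * R -> C)
  (c_proper : proper_colouring (@unit_distance_graph R) c)
  (c_local : exists (P : R * R) (H H' N : set (R * R)) (a b : C),
    [/\ complementary_half_planes H H' /\ (H `&` H') P,
        nbhs P N,
        a <> b,
        (forall p : R * R, interior (H `&` N) p -> c p = a) &
        (forall p : R * R, interior (H' `&` N) p -> c p = b)]) :
  uses_at_least 5 c.
Proof.
case: c_local => P [H [H' [N [a [b [[[u [t [u_neq0 -> ->]]]]]]]]]].
rewrite half_planeI => Pt PN ab ca cb.
have [s [w [s0 uE w1]]] := unit_vector_scaling u_neq0.
have [e e0 eN] := frame_near w1 (nbhs_interior PN).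
have height q : u.1 * (frame P w q).1 + u.2 * (frame P w q).2 = t + s * q.2.
  rewrite -Pt uE /=; transitivity (s * w.1 * P.1 + s * w.2 * P.2 +
    s * q.2 * (w.1 ^+ 2 + w.2 ^+ 2)); first by ring.
  by rewrite w1 mulr1.
have five : uses_at_least 5 (c \o frame P w).
  apply: (straight_boundary_five_colours _ e a b) => //.
  - by move=> p q pq; apply: c_proper; exact: frame_unit_distance.
  - move=> q qe q0; apply: ca; rewrite interiorI; split; last exact: eN.
    by apply: open_half_plane_interior; rewrite /= height ltrDl mulr_gt0.
  - move=> q qe q0; apply: cb; rewrite interiorI; split; last exact: eN.
    apply: open_half_plane_interior.
    by rewrite /= !mulNr -opprD ltrN2 height gtrDl pmulr_rlt0.
apply: card_le_trans five _; apply: subset_card_le.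
by move=> _ [q _ <-]; exists (frame P w q).
Qed.
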